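(* Define the sampling measure $\mu$ on $\mathcal X$ and the corresponding weight functional $w$ by $$d\mu(f)=\frac{\sum_{n=1}^N\|\Phi_n(f)\|_{\mathcal Y}^2}{N}\,d\rho(f),\qquad w(f)=\frac{d\rho}{d\mu}(f)=\frac{N}{\sum_{n=1}^N\|\Phi_n(f)\|^2_{\mathcal Y}} .$$ Then $\mu$ is a probability measure, $\rho\ll\mu$ and $w=\frac{d\rho}{d\mu}>0$, and this choice minimizes the weighted Nikolskii constant $\kappa^\infty_{w}$ among all pairs $(\mu',w')$ consisting of a probability measure $\mu'$ on $\mathcal X$ with $\rho\ll\mu'$ and $w'=\frac{d\rho}{d\mu'}>0$, resulting in $\kappa_w^\infty=N$.
   Context: $\mathcal X$ and $\mathcal Y$ are separable Hilbert spaces and $\rho$ is a probability measure on $(\mathcal X,\mathscr F)$, with $\mathscr F$ a $\sigma$-algebra on $\mathcal X$. $L^2_\rho=L^2_\rho(\mathcal X;\mathcal Y)$ is the Bochner space of (not necessarily linear) measurable maps $A:\mathcal X\to\mathcal Y$ with $\|A\|_{L^2_\rho}^2=\int_{\mathcal X}\|A(f)\|_{\mathcal Y}^2\,d\rho(f)<\infty$ and inner product $\langle A,B\rangle_{L^2_\rho}=\int_{\mathcal X}\langle A(f),B(f)\rangle_{\mathcal Y}\,d\rho(f)$. $V\subset L^2_\rho$ is an $N$-dimensional subspace ($N\in\mathbb N$) with an $L^2_\rho$-orthonormal basis $\Phi_1,\dots,\Phi_N$. The notation $\rho\ll\mu$ means that $\mu(E)=0$ implies $\rho(E)=0$ for every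 $E\in\mathscr F$. Weighted Nikolskii constant of a weight functional $w:\mathcal X\to\mathbb R_+$: $\kappa_w(f)=\sum_{n=1}^N w(f)\|\Phi_n(f)\|_{\mathcal Y}^2$ and $\kappa_w^\infty=\|\kappa_w\|_{L^\infty_\rho(\mathcal X;\mathbb R)}=\operatorname{ess\,sup}_{f}\kappa_w(f)$, where the essential supremum is with respect to $\rho$ (it may be $+\infty$).
   Formalization: The formal theorem adds the hypothesis that the sum of ‖Φ_n(f)‖² is positive for ρ-almost every f; without it w is undefined on a set of positive ρ-measure and ρ≪μ fails (e.g. N=1, Φ_1 a multiple of an indicator of a set of ρ-measure in (0,1)). *)

(* Defs.v *)
From HB Require Import structures.
From mathcomp Require Import all_boot all_order all_algebra.
From mathcomp Require Import sesquilinear.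
From mathcomp Require Import complex.
From mathcomp Require Import all_classical all_reals all_analysis.
From mathcomp Require Import ess_sup_inf.

Set Implicit Arguments.
Unset Strict Implicit.
Unset Printing Implicit Defensive.

Import Order.TTheory GRing.Theory Num.Theory.
Import numFieldNormedType.Exports.

Local Open Scope classical_set_scope.
Local Open Scope ring_scope.
Local Open Scope charge_scope.

(* Hilbert spaces are over the field of real or of complex numbers.
   [complex R] is the field R[i]. *)
Variant scalar_kind := RealScalars | ComplexScalars.

Definition scalar_field (R : realType) (k : scalar_kind) : numFieldType :=
  match k with
  | RealScalars => R
  | ComplexScalars => complex R
  end.

Definition scalar_re (R : realType) (k : scalar_kind) : scalar_field R k -> R :=
  match k return scalar_field R k -> R with
  | RealScalars => fun z => z
  | ComplexScalars => fun z => complex.Re z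
  end.

Definition scalar_conj (R : realType) (k : scalar_kind) :
    scalar_field R k -> scalar_field R k :=
  match k return scalar_field R k -> scalar_field R k with
  | RealScalars => fun z => z
  | ComplexScalars => fun z => conjc z
  end.

Definition separable_space (T : topologicalType) : Prop :=
  exists2 D : set T, countable D & dense D.

(* The inner product is linear in its first argument and conjugate-linear in
   its second one. *)
Record separableHilbert (R : realType) (k : scalar_kind) := SeparableHilbert {
  hilbert_space :> completeNormedModType (scalar_field R k);
  hilbert_inner : {dot hilbert_space for @scalar_conj R k};
  hilbert_normE : forall x : hilbert_space, `|x| ^+ 2 = hilbert_inner x x;
  hilbert_separable : separable_space hilbert_space
}.

Arguments hilbert_inner {R k} s.

(* In a normed module over K the norm has values in K; this is the same norm
   with values in R. *)
Definition hnorm (R : realType) (k : scalar_kind) (Y : separableHilbert R k)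
  (y : Y) : R := scalar_re `|y|.

Section Bochner.
Context {R : realType} {k : scalar_kind} {X Y : separableHilbert R k}.
Context {F : set (set X)}.

Implicit Types (rho mu : probability (g_sigma_algebraType F) R).
Implicit Types (A B : X -> Y) (w : X -> R).

(* Since Y is separable, strong (Bochner) measurability is measurability for
   the Borel sigma-algebra of Y. *)
Definition borel_measurable A : Prop :=
  measurable_fun [set: g_sigma_algebraType F]
    (A : g_sigma_algebraType F -> g_sigma_algebraType (@open Y)).

(* Elements of L^2 are represented by functions, equality in L^2 being
   equality rho-almost everywhere. *)
Definition bochnerL2 rho : set (X -> Y) :=
  [set A | borel_measurable A /\
           (\int[rho]_f ((hnorm (A f)) ^+ 2)%:E < +oo)%E].

(* The integral of a function with values in the scalar field. *)
Definition scalar_integral rho : (X -> scalar_field R k) -> scalar_field R k :=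
  match k return (X -> scalar_field R k) -> scalar_field R k with
  | RealScalars => fun g => \int[rho]_f g f
  | ComplexScalars => fun g =>
      Complex (\int[rho]_f complex.Re (g f)) (\int[rho]_f complex.Im (g f))
  end.

Definition innerL2 rho A B : scalar_field R k :=
  scalar_integral rho (fun f => hilbert_inner Y (A f) (B f)).

Definition orthonormal_basisL2 rho (N : nat) (V : set (X -> Y))
    (Phi : 'I_N -> X -> Y) : Prop :=
  [/\ forall n, bochnerL2 rho (Phi n),
      forall m n, innerL2 rho (Phi m) (Phi n) = (m == n)%:R &
      V = [set A | bochnerL2 rho A /\
             exists c : 'I_N -> scalar_field R k,
               {ae rho, forall f, A f = \sum_(n < N) c n *: Phi n f}]].

Definition sum_sqnorm (N : nat) (Phi : 'I_N -> X -> Y) (f : X) : R :=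
  \sum_(n < N) (hnorm (Phi n f)) ^+ 2.

Definition sampling_measure rho (N : nat) (Phi : 'I_N -> X -> Y) (E : set X) :
    \bar R :=
  (\int[rho]_(f in (E : set (g_sigma_algebraType F)))
     (sum_sqnorm Phi f / N%:R)%:E)%E.

(* Where the denominator vanishes the value is 0 instead of +oo. *)
Definition sampling_weight (N : nat) (Phi : 'I_N -> X -> Y) (f : X) : R :=
  N%:R / sum_sqnorm Phi f.

Definition kappa (N : nat) (Phi : 'I_N -> X -> Y) w (f : X) : R :=
  \sum_(n < N) w f * (hnorm (Phi n f)) ^+ 2.

Definition kappa_inf rho (N : nat) (Phi : 'I_N -> X -> Y) w : \bar R :=
  ess_sup rho (fun f => (kappa Phi w f)%:E).

(* A Radon-Nikodym derivative, and hence its positivity, is determined only up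
   to mu-null sets. *)
Definition admissible rho mu w : Prop :=
  [/\ rho `<< mu,
      measurable_fun [set: g_sigma_algebraType F] w,
      {ae mu, forall f, (w f)%:E = ('d (charge_of_finite_measure rho) '/d mu) f} &
      {ae mu, forall f, 0 < w f}].

End Bochner.

(* Main.v *)
Require Import Defs.
From HB Require Import structures.
From mathcomp Require Import all_boot all_order all_algebra.
From mathcomp Require Import all_classical all_reals all_analysis.
From mathcomp Require Import measurable_realfun complex ess_sup_inf.

Set Implicit Arguments.
Unset Strict Implicit.
Unset Printing Implicit Defensive.

Import Order.TTheory GRing.Theory Num.Theory.
Import numFieldNormedType.Exports.

(** Write S for the function sum_sqnorm Phi, so that kappa Phi w = w * S.
    Orthonormality says that each ||Phi_n||^2 has rho-integral 1, hence S has
    rho-integral N and S / N is a probability density; it defines mu.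

    Since S > 0 rho-almost everywhere, mu and rho have the same null sets, and
    the chain rule (d rho / d mu) (d mu / d rho) = 1 identifies d rho / d mu
    with N / S.  For this weight w * S is constantly N off a null set, so its
    essential supremum is N.

    No other pair does better, by an averaging argument
    (integral_le_ess_sup_weighted): if w' = d rho / d mu', then w' * S has
    mu'-integral equal to the rho-integral of S, namely N, and an average
    against a probability measure is at most the essential supremum.  The
    essential supremum in question is taken for rho rather than mu', which is
    harmless because w' > 0 makes mu' absolutely continuous with respect to
    rho.

    The argument about densities is valid on any measurable space.  The Hilbert
    space structure enters only through the measurability of the norm and the
    identity <y, y> = ||y||^2, which have to be read off for real and complex
    scalars at once. *)

Local Open Scope classical_set_scope.
Local Open Scope ring_scope.
Local Open Scope charge_scope.

(** * Densities between probability measures *)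

Section densities.
Context {d : measure_display} {T : measurableType d} {R : realType}.
Implicit Types (mu nu rho : probability T R).

Lemma ae_null_dominates mu nu (P : T -> Prop) :
  nu `<< mu -> {ae mu, forall x, P x} -> {ae nu, forall x, P x}.
Proof.
move=> /null_content_dominatesP numu [A [mA A0 PA]].
by exists A; split => //; exact: numu.
Qed.

Lemma ae_imply mu (P Q : T -> Prop) :
  (forall x, P x -> Q x) -> {ae mu, forall x, P x} -> {ae mu, forall x, Q x}.
Proof. by move=> PQ; apply: filterS. Qed.

Lemma ae_imply2 mu (P Q S : T -> Prop) :
  (forall x, P x -> Q x -> S x) -> {ae mu, forall x, P x} ->
  {ae mu, forall x, Q x} -> {ae mu, forall x, S x}.
Proof. by move=> PQS; apply: filterS2. Qed.

(** A nonnegative function whose integral over E vanishes is zero almost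
    everywhere on E; an almost everywhere positive one leaves no room for this
    unless E is null. *)
Lemma ae_gt0_density_dominates mu nu (f : T -> \bar R) :
    measurable_fun setT f ->
    (forall E, measurable E -> nu E = (\int[mu]_(x in E) f x)%E) ->
    {ae mu, forall x, (0 < f x)%E} ->
  mu `<< nu.
Proof.
move=> mf nuE f0; apply/null_content_dominatesP => E mE.
have mfE : measurable_fun E f by exact: measurable_funTS.
move=> nuE0; have : (\int[mu]_(x in E) f x = 0)%E by rewrite -nuE.
rewrite (@ae_eq_integral _ _ _ _ _ (fun x => `|f x|%E))//; last 2 first.
- exact: measurableT_comp.
- by apply: filterS f0 => x fx0 _; rewrite gee0_abs ?ltW.
move=> /(ae_eq_integral_abs mu mE mfE) fE0.
have : {ae mu, forall x, ~ E x}.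
  by apply: filterS2 f0 fE0 => x fx0 /[swap] Ex /(_ Ex) fx; rewrite fx ltxx in fx0.
move=> [A [mA A0 EA]]; apply: (subset_measure0 mE mA _ A0).
by move=> x Ex; apply: EA => /=; exact.
Qed.

Lemma density_dominated mu nu (f : T -> \bar R) :
    measurable_fun setT f ->
    (forall E, measurable E -> nu E = (\int[mu]_(x in E) f x)%E) ->
  nu `<< mu.
Proof.
move=> mf nuE; apply/null_content_dominatesP => E mE E0.
by rewrite [LHS]nuE// null_set_integral//; exact: measurable_funTS.
Qed.

Lemma Radon_Nikodym_unique mu nu (f : T -> \bar R) :
    mu.-integrable setT f ->
    (forall E, measurable E -> nu E = (\int[mu]_(x in E) f x)%E) ->
  ae_eq mu setT f ('d (charge_of_finite_measure nu) '/d mu).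
Proof.
move=> fi nuE; have numu := density_dominated (measurable_int mu fi) nuE.
apply: integral_ae_eq => //.
by move=> E _ mE; rewrite -nuE// -Radon_Nikodym_integral.
Qed.

(** This is d mu / d nu * d nu / d mu = d mu / d mu = 1.  The equation is
    multiplicative so as not to divide in the extended reals. *)
Lemma Radon_Nikodym_density_inverse mu nu (f : T -> \bar R) :
    mu.-integrable setT f ->
    (forall E, measurable E -> nu E = (\int[mu]_(x in E) f x)%E) ->
    {ae mu, forall x, (0 < f x)%E} ->
  {ae nu, forall x, (('d (charge_of_finite_measure mu) '/d nu) x * f x = 1)%E}.
Proof.
move=> fi nuE f0; have mf := measurable_int mu fi.
have numu := density_dominated mf nuE.
have munu := ae_gt0_density_dominates mf nuE f0.
apply: (ae_null_dominates numu).
have dmumu : ae_eq mu setT (cst 1%E)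
    ('d (charge_of_finite_measure mu) '/d mu).
  apply: Radon_Nikodym_unique; first exact: finite_measure_integrable_cst.
  by move=> E mE; rewrite integral_cst// mul1e.
have dnumu := Radon_Nikodym_unique fi nuE.
have := Radon_Nikodym_chain_rule (nu := charge_of_finite_measure mu) munu numu.
apply: filterS3 dmumu dnumu => x /= /(_ I) dmumux /(_ I) dnumux /(_ I) chain.
by rewrite dnumux -chain -dmumux.
Qed.

Lemma ge0_integrable rho (g : T -> R) :
    measurable_fun setT g -> (forall x, 0 <= g x) ->
    (\int[rho]_x (g x)%:E < +oo)%E ->
  rho.-integrable setT (EFin \o g).
Proof.
move=> mg g0 goo; apply/integrableP; split; first exact/measurable_EFinP.
by rewrite (eq_integral (fun x => (g x)%:E))// => x _; rewrite /= ger0_norm.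
Qed.

Lemma density_probability rho (g : T -> R) :
    measurable_fun setT g -> (forall x, 0 <= g x) ->
    (\int[rho]_x (g x)%:E = 1)%E ->
  exists mu : probability T R,
    forall E, measurable E -> mu E = (\int[rho]_(x in E) (g x)%:E)%E.
Proof.
move=> mg g0 g1.
pose m (E : set T) := (\int[rho]_(x in E) (g x)%:E)%E.
have m0 : m set0 = 0%E by rewrite /m integral_set0.
have m_ge0 E : (0 <= m E)%E by apply: integral_ge0 => x _; rewrite lee_fin.
have m_sigma : semi_sigma_additive m.
  apply: semi_sigma_additive_nng_induced; first exact/measurable_EFinP.
  by move=> x; rewrite lee_fin.
pose mM := isMeasure.Build _ _ _ m m0 m_ge0 m_sigma.
pose M : {measure set T -> \bar R} := HB.pack m mM.
pose mP := Measure_isProbability.Build _ _ _ M g1.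
pose P : probability T R := HB.pack m mM mP.
by exists P.
Qed.

(** The change of variables turns the rho-integral of g into the mu-integral of
    w * g, an average with respect to a probability measure of a function
    bounded by its essential supremum. *)
Lemma integral_le_ess_sup_weighted rho mu (g w : T -> R) :
    (forall x, 0 <= g x) -> rho.-integrable setT (EFin \o g) ->
    measurable_fun setT w ->
    rho `<< mu ->
    {ae mu, forall x, (w x)%:E = ('d (charge_of_finite_measure rho) '/d mu) x} ->
    {ae mu, forall x, 0 < w x} ->
  (\int[rho]_x (g x)%:E <= ess_sup rho (fun x => (w x * g x)%:E))%E.
Proof.
move=> g0 gi mw rhomu wE w0.
have mg : measurable_fun setT g by apply/measurable_EFinP; exact: measurable_int gi.
have mwg : measurable_fun setT (EFin \o (fun x => w x * g x)).
  by apply/measurable_EFinP; exact: measurable_funM.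
have murho : mu `<< rho.
  apply: (@ae_gt0_density_dominates _ _ ('d (charge_of_finite_measure rho) '/d mu)) => //.
  - by move=> E mE; rewrite -Radon_Nikodym_integral.
  - by apply: filterS2 wE w0 => x <-; rewrite lte_fin.
rewrite -(Radon_Nikodym_change_of_variables rhomu)//.
(* The absolute value makes the integrand nonnegative everywhere, whereas
   w * g is so only almost everywhere. *)
rewrite (@ae_eq_integral _ _ _ _ _ (fun x => `|(w x * g x)%:E|%E))//; first last.
- by apply: filterS2 wE w0 => x <- wx0 _; rewrite /= ger0_norm ?mulr_ge0// 1?ltW// mulrC.
- exact: measurableT_comp.
- by apply: emeasurable_funM => //; exact: measurable_int gi.
set c := ess_sup _ _.
have wgc : {ae mu, forall x, ((w x * g x)%:E <= c)%E}.
  exact/(ae_null_dominates murho)/ess_sup_ge.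
have muT : (mu setT = 1)%E by exact: probability_setT.
have ae_proper : ProperFilter (almost_everywhere mu).
  by apply: ae_properfilter_algebraOfSetsType; rewrite [ltRHS]muT.
(* A bound valid almost everywhere for mu holds at some point, as mu is not
   zero. *)
have c0 : (0 <= c)%E.
  have [x [wgx wx]] := filter_ex (filterI wgc w0).
  by apply: le_trans wgx; rewrite lee_fin mulr_ge0// ltW.
have -> : c = (\int[mu]_x cst c x)%E by rewrite integral_cst// [X in (_ * X)%E]muT mule1.
apply: ae_ge0_le_integral => //; first exact: measurableT_comp.
apply: filterS2 wgc w0 => x wgx wx _.
by rewrite /= ger0_norm ?mulr_ge0// ltW.
Qed.

End densities.

(** * The real-valued norm of a Hilbert space *)

Section hilbert_norm.
Context {R : realType} {k : scalar_kind}.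

(** The topology of Y comes from balls whose radii are scalars.  A complex
    number of the form |y| has zero imaginary part, so comparing it with the
    complex number r is comparing real parts, and the set is a ball. *)
Lemma open_hnorm_lt (Y : separableHilbert R k) (r : R) :
  open [set y : Y | hnorm y < r].
Proof.
have [e He] : exists e : scalar_field R k, forall y : Y, (hnorm y < r) = (`|y| < e).
  rewrite /hnorm; case: k Y => /= Y; first by exists r.
  exists (r%:C)%C => y.
  have := normr_ge0 y; rewrite !lecE/= => /andP[/eqP im0 _].
  by rewrite ltcE/= im0 eqxx.
rewrite (_ : [set y | _] = ball (0 : Y) e); first exact: ball_open.
by apply/seteqP; split => y; rewrite -ball_normE /ball_/= sub0r normrN He.
Qed.

Lemma hnorm_sqr_inner (Y : separableHilbert R k) (y : Y) :
  scalar_re (hilbert_inner Y y y) = hnorm y ^+ 2.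
Proof.
rewrite -hilbert_normE /hnorm.
have := normr_ge0 y; case: k Y y => //= Y y.
rewrite lecE => /andP[/eqP/= im0 _].
by case: (`|y|) im0 => a b /= ->; rewrite mulr0 subr0 expr2.
Qed.

Lemma measurable_hnorm (Y : separableHilbert R k) :
  measurable_fun [set: g_sigma_algebraType (@open Y)]
    (@hnorm R k Y : g_sigma_algebraType (@open Y) -> R).
Proof.
apply: (measurability _ (RGenInftyO.measurableE R)) => _ [_ [r ->] <-].
rewrite setTI; apply: sub_sigma_algebra.
rewrite (_ : _ @^-1` _ = [set y : Y | hnorm y < r]); first exact: open_hnorm_lt.
by apply/seteqP; split => y /=; rewrite in_itv.
Qed.

End hilbert_norm.

(** * Orthonormal families in L2 *)

Lemma scalar_re_integral (R : realType) (k : scalar_kind)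
    (X : separableHilbert R k) (F : set (set X))
    (rho : probability (g_sigma_algebraType F) R) (g : X -> scalar_field R k) :
  scalar_re (scalar_integral rho g) = \int[rho]_f scalar_re (g f).
Proof. by case: k X F rho g. Qed.

Section orthonormal.
Context {R : realType} {k : scalar_kind} {X Y : separableHilbert R k}.
Context {F : set (set X)}.
Variable rho : probability (g_sigma_algebraType F) R.

Lemma measurable_sqr_hnorm (A : X -> Y) :
  borel_measurable (F := F) A ->
  measurable_fun [set: g_sigma_algebraType F] (fun f => hnorm (A f) ^+ 2).
Proof.
move=> mA; apply: measurable_funX.
exact: (measurableT_comp (@measurable_hnorm R k Y) mA).
Qed.

(** Taking real parts of <A, A> = 1 gives a statement on the real-valued
    integral; finiteness from A being in L2 lifts it to the extended reals. *)
Lemma integral_sqr_hnorm_unit (A : X -> Y) :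
  bochnerL2 rho A -> innerL2 rho A A = 1 ->
  (\int[rho]_f (hnorm (A f) ^+ 2)%:E = 1)%E.
Proof.
move=> [mA Aoo] A1.
have /(congr1 (@scalar_re R k)) := A1.
rewrite /innerL2 scalar_re_integral.
rewrite (_ : scalar_re 1 = 1); last by case: (k).
under eq_Rintegral do rewrite hnorm_sqr_inner.
move=> <-; rewrite /Rintegral fineK// ge0_fin_numE//.
by apply: integral_ge0 => f _; rewrite lee_fin sqr_ge0.
Qed.

Lemma sum_sqnorm_ge0 (N : nat) (Phi : 'I_N -> X -> Y) (f : X) :
  0 <= sum_sqnorm Phi f.
Proof. by apply: sumr_ge0 => n _; exact: sqr_ge0. Qed.

Lemma kappaE (N : nat) (Phi : 'I_N -> X -> Y) (w : X -> R) (f : X) :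
  kappa Phi w f = w f * sum_sqnorm Phi f.
Proof. by rewrite /kappa -mulr_sumr. Qed.

Lemma kappa_infE (N : nat) (Phi : 'I_N -> X -> Y) (w : X -> R) :
  kappa_inf rho Phi w = ess_sup rho (fun f => (w f * sum_sqnorm Phi f)%:E).
Proof.
by rewrite /kappa_inf; congr ess_sup; apply/funext => f; rewrite kappaE.
Qed.

Lemma measurable_sum_sqnorm (N : nat) (Phi : 'I_N -> X -> Y) :
  (forall n, bochnerL2 rho (Phi n)) ->
  measurable_fun [set: g_sigma_algebraType F] (sum_sqnorm Phi).
Proof.
move=> L2; apply: measurable_sum => n; apply: measurable_sqr_hnorm.
by have [] := L2 n.
Qed.

Lemma integral_sum_sqnorm (N : nat) (V : set (X -> Y)) (Phi : 'I_N -> X -> Y) :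
  orthonormal_basisL2 rho V Phi ->
  (\int[rho]_f (sum_sqnorm Phi f)%:E = N%:R%:E)%E.
Proof.
move=> [L2 orth _]; rewrite /sum_sqnorm.
under eq_integral do rewrite -sumEFin.
rewrite ge0_integral_sum//; first last.
- by move=> n f _; rewrite lee_fin sqr_ge0.
- move=> n; apply/measurable_EFinP; apply: measurable_sqr_hnorm.
  by have [] := L2 n.
under eq_bigr do rewrite integral_sqr_hnorm_unit ?orth ?eqxx//.
by rewrite sumEFin sumr_const card_ord.
Qed.

End orthonormal.

(** * The optimal sampling measure *)

Theorem theorem3p2 (R : realType) (k : scalar_kind)
    (X Y : separableHilbert R k)
    (F : set (set X)) (hF : sigma_algebra [set: X] F)
    (rho : probability (g_sigma_algebraType F) R)
    (N : nat) (hN : (0 < N)%N)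
    (V : set (X -> Y)) (Phi : 'I_N -> X -> Y)
    (hPhi : orthonormal_basisL2 rho V Phi)
    (hw : {ae rho, forall f, 0 < sum_sqnorm Phi f}) :
  exists mu : probability (g_sigma_algebraType F) R,
    [/\ forall E : set (g_sigma_algebraType F), measurable E ->
          mu E = sampling_measure rho Phi E,
        admissible rho mu (sampling_weight Phi),
        forall (mu' : probability (g_sigma_algebraType F) R) (w' : X -> R),
          admissible rho mu' w' ->
          (kappa_inf rho Phi (sampling_weight Phi) <= kappa_inf rho Phi w')%E &
        kappa_inf rho Phi (sampling_weight Phi) = N%:R%:E].
Proof.
have N0 : 0 < N%:R :> R by rewrite ltr0n.
have mS : measurable_fun [set: g_sigma_algebraType F] (sum_sqnorm Phi).
  by apply: (@measurable_sum_sqnorm _ _ _ _ _ rho); case: hPhi.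
have intS := integral_sum_sqnorm hPhi.
have iS : rho.-integrable [set: g_sigma_algebraType F] (EFin \o sum_sqnorm Phi).
  by apply: ge0_integrable => //; [exact: sum_sqnorm_ge0 | rewrite intS ltry].
pose g f := sum_sqnorm Phi f / N%:R.
have g0 f : 0 <= g f by rewrite divr_ge0 ?sum_sqnorm_ge0// ltW.
have mg : measurable_fun [set: g_sigma_algebraType F] g.
  exact: measurable_funM.
have g1 : (\int[rho]_f (g f)%:E = 1)%E.
  rewrite /g; under eq_integral do rewrite EFinM.
  rewrite ge0_integralZr//=; first last.
  - by move=> f _; rewrite lee_fin sum_sqnorm_ge0.
  - exact/measurable_EFinP.
  by rewrite intS -EFinM divff// gt_eqF.
have gi : rho.-integrable [set: g_sigma_algebraType F] (EFin \o g).
  by apply: ge0_integrable => //; rewrite g1 ltry.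
have [mu muE] := density_probability mg g0 g1.
have gpos : {ae rho, forall f, (0 < (EFin \o g) f)%E}.
  by apply: ae_imply hw => f Sf; rewrite lte_fin divr_gt0.
have rhomu : rho `<< mu.
  apply: ae_gt0_density_dominates gpos; last exact: muE.
  exact: measurable_int gi.
have murho : mu `<< rho.
  exact: (density_dominated (measurable_int _ gi) muE).
have kN : kappa_inf rho Phi (sampling_weight Phi) = N%:R%:E.
  apply: ess_sup_ae_cst; first by rewrite [ltRHS]probability_setT.
  apply: ae_imply hw => f Sf.
  by rewrite kappaE /sampling_weight divfK// gt_eqF.
exists mu; split => //.
- split => //.
  (* Both 0^-1 and 0 `^ (-1) are 0, so the inverse of S is measurable as a
     power function of S. *)
  + rewrite (_ : sampling_weight Phi =
      (fun f => N%:R * (sum_sqnorm Phi f) `^ (-1))); last first.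
      by apply/funext => f; rewrite powR_inv1 ?sum_sqnorm_ge0.
    apply: measurable_funM => //.
    exact: (measurableT_comp (measurable_powR _) mS).
  + have := Radon_Nikodym_density_inverse gi muE gpos.
    apply: ae_imply2 (ae_null_dominates murho hw) => f Sf.
    have := @Radon_Nikodym_fin_num _ _ _ (charge_of_finite_measure rho) mu f rhomu.
    case: (Radon_Nikodym _ _ _) => // r _ /= [rg].
    have gn0 : g f != 0 by rewrite gt_eqF// divr_gt0.
    by congr EFin; rewrite -(mulfK gn0 r) rg mul1r invf_div.
  + apply: (ae_null_dominates murho); apply: ae_imply hw => f Sf.
    by rewrite divr_gt0.
- move=> mu' w' [rhomu' mw' w'E w'0]; rewrite kN -intS.
  rewrite kappa_infE.
  exact: (@integral_le_ess_sup_weighted _ _ _ rho mu' (sum_sqnorm Phi) w'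
            (sum_sqnorm_ge0 Phi) iS mw' rhomu' w'E w'0).
Qed.
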